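(* Let $\mathcal{G}$ be a groupoid such that $\mathcal{G}_0$ is finite, $A$ a $\mathcal{G}$-graded algebra and $X$ a finite split $\mathcal{G}$-set via $\alpha=(X_g,\alpha_g)_{g\in\mathcal{G}}$. Then the category $(\mathcal{G},X,A)$ of $X$-graded left $A$-modules and the category ${}_{A\#_\alpha^{\mathcal{G}}X}\mathcal{M}$ of left $A\#_\alpha^{\mathcal{G}}X$-modules are isomorphic.
   Context: All algebras are associative and unital over a fixed field $\Bbbk$ (and modules are unital). A groupoid $\mathcal{G}$ is a small category in which every morphism is invertible; it is identified with its set of morphisms. $d(g), r(g)$ are the domain and range of $g$, $\mathcal{G}_0$ is the set of objects, identified with the identity morphisms, so $\mathcal{G}_0\subseteq\mathcal{G}$. The product $gh$ is defined iff $d(g)=r(h)$. An action of $\mathcal{G}$ on a set $X$ is $\alpha=(X_g,\alpha_g)_{g\in\mathcal{G}}$ with $X_g=X_{r(g)}\subseteq X$ and $\alpha_g:X_{g^{-1}}\to X_g$ bijections such that $\alpha_e=\mathrm{id}_{X_e}$ for $e\in\mathcal{G}_0$, and $\alpha_g(\alpha_h(x))=\alpha_{gh}(x)$ whenever $d(g)=r(h)$ and $x\in X_{h^{-1}}$. Then $X$ is a $\mathcal{G}$-set; it is split if $X=\coprod_{e\in\mathcal{G}_0}X_e$ (disjoint union). An algebra $A$ is $\mathcal{G}$-graded if $A=\oplus_{g\in\mathcal{G}}A_g$ for subspaces $A_g$ with $A_gA_h\subseteq A_{gh}$ if $d(g)=r(h)$ and $A_gA_h=0$ otherwise. When $\mathcal{G}_0$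 is finite, each $A_e$ ($e\in\mathcal{G}_0$) is unital with identity $1_e$ and $1_A=\sum_e1_e$. The smash product is $A\#_\alpha^{\mathcal{G}}X=\oplus_{g\in\mathcal{G}}\oplus_{x\in X_{d(g)}}A_g\delta_x$ ($\delta_x$ symbols) with $(a_g\delta_x)(b_h\delta_y)=a_gb_h\delta_y$ if $d(g)=r(h)$ and $\alpha_h(y)=x$, and $0$ otherwise; its identity is $\sum_{e\in\mathcal{G}_0}\sum_{x\in X_e}1_e\delta_x$. A left $A$-module $M$ is $X$-graded if it is equipped with a family $\{M_x\}_{x\in X}$ of vector subspaces with $M=\oplus_{x\in X}M_x$ such that, for all $g\in\mathcal{G}$, $x\in X$, $A_gM_x\subseteq M_{\alpha_g(x)}$ if $x\in X_{d(g)}$ and $A_gM_x=0$ otherwise. A morphism in $(\mathcal{G},X,A)$ is an $A$-module morphism $\phi:M\to N$ with $\phi(M_x)\subseteq N_x$ for all $x\in X$. *)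

(* Defs.v *)
From HB Require Import structures.
From mathcomp Require Import all_boot all_order all_algebra.
From mathcomp Require Import finmap boolp.
From mathcomp.multinomials Require Import monalg.
Set Implicit Arguments.
Unset Strict Implicit.
Unset Printing Implicit Defensive.
Import GRing.Theory.
Local Open Scope ring_scope.

Record category := Category {
  ob :> Type;
  hom : ob -> ob -> Type;
  idc : forall c, hom c c;
  compc : forall a b c, hom b c -> hom a b -> hom a c;
  comp1c : forall a b (f : hom a b), compc (idc b) f = f;
  compc1 : forall a b (f : hom a b), compc f (idc a) = f;
  compcA : forall a b c d (f : hom c d) (g : hom b c) (h : hom a b),
    compc f (compc g h) = compc (compc f g) h }.

Arguments idc {C} c : rename.
Arguments compc {C a b c} : rename.

Record functor (C D : category) := Functor {
  fob :> C -> D;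
  fhom : forall a b, hom a b -> hom (fob a) (fob b);
  fhom_id : forall a, fhom (idc a) = idc (fob a);
  fhom_comp : forall a b c (f : hom b c) (g : hom a b),
    fhom (compc f g) = compc (fhom f) (fhom g) }.

Definition functor_id (C : category) : functor C C :=
  @Functor C C id (fun _ _ f => f) (fun _ => erefl) (fun _ _ _ _ _ => erefl).

Section FunctorComp.
Variables (C D E : category) (F : functor D E) (G : functor C D).

Fact functor_comp_id c : fhom F (fhom G (idc c)) = idc (F (G c)).
Proof. by rewrite !fhom_id. Qed.

Fact functor_comp_comp a b c (f : hom b c) (g : hom a b) :
  fhom F (fhom G (compc f g)) = compc (fhom F (fhom G f)) (fhom F (fhom G g)).
Proof. by rewrite !fhom_comp. Qed.

Definition functor_comp : functor C E :=
  @Functor C E (fun c => F (G c)) (fun _ _ f => fhom F (fhom G f))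
    functor_comp_id functor_comp_comp.
End FunctorComp.

Definition isomorphic_categories (C D : category) : Prop :=
  exists (F : functor C D) (G : functor D C),
    functor_comp G F = functor_id C /\ functor_comp F G = functor_id D.

(* A groupoid is identified with its set of morphisms; the objects [O] embed in
   it through [idm]. The value [compg g h] is junk unless [dom g = rng h]. *)
Record groupoid (O : choiceType) := Groupoid {
  mor :> choiceType;
  dom : mor -> O;
  rng : mor -> O;
  idm : O -> mor;
  compg : mor -> mor -> mor;
  invm : mor -> mor;
  dom_id : forall e, dom (idm e) = e;
  rng_id : forall e, rng (idm e) = e;
  dom_comp : forall g h, dom g = rng h -> dom (compg g h) = dom h;
  rng_comp : forall g h, dom g = rng h -> rng (compg g h) = rng g;
  compgA : forall g h l, dom g = rng h -> dom h = rng l ->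
    compg g (compg h l) = compg (compg g h) l;
  comp1g : forall g, compg (idm (rng g)) g = g;
  compg1 : forall g, compg g (idm (dom g)) = g;
  dom_inv : forall g, dom (invm g) = rng g;
  rng_inv : forall g, rng (invm g) = dom g;
  compgV : forall g, compg g (invm g) = idm (rng g);
  compVg : forall g, compg (invm g) g = idm (dom g) }.

Arguments idm {O} G e : rename.

(* [act_set g] is the subset X_g and [act g], restricted to [act_set (invm g)],
   the bijection X_{g^-1} -> X_g; [act g x] is junk elsewhere. *)
Record action (O : choiceType) (G : groupoid O) (X : finType) := Action {
  act_set : G -> {set X};
  act :> G -> X -> X;
  act_set_rng : forall g, act_set g = act_set (idm G (rng g));
  act_inj : forall g, {in act_set (invm g) &, injective (act g)};
  act_img : forall g, act g @: act_set (invm g) = act_set g;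
  act_id : forall e, {in act_set (idm G e), act (idm G e) =1 id};
  act_comp : forall g h, dom g = rng h ->
    {in act_set (invm h), forall x, act g (act h x) = act (compg g h) x} }.

Definition split_action (O : choiceType) (G : groupoid O) (X : finType)
    (al : action G X) : Prop :=
  (forall x, exists e, x \in act_set al (idm G e)) /\
  (forall e e', e != e' ->
     [disjoint act_set al (idm G e) & act_set al (idm G e')]).

(* Unital algebras over [k]. MathComp's [algType] excludes the zero ring, but
   the smash product below is the zero ring when, for instance, [X] is empty. *)

HB.mixin Record isPzAlgebra (k : pzRingType) A of GRing.PzRing A := {
  ascale : k -> A -> A;
  ascaleA : forall c d a, ascale c (ascale d a) = ascale (c * d) a;
  ascale1 : forall a, ascale 1 a = a;
  ascaleDr : forall c a b, ascale c (a + b) = ascale c a + ascale c b;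
  ascaleDl : forall a c d, ascale (c + d) a = ascale c a + ascale d a;
  ascaleAl : forall c a b, ascale c (a * b) = ascale c a * b;
  ascaleAr : forall c a b, ascale c (a * b) = a * ascale c b }.

#[short(type="pzAlgType")]
HB.structure Definition PzAlgebra (k : pzRingType) :=
  { A of GRing.PzRing A & isPzAlgebra k A }.

(* A module over the algebra [A] is an [lmodType A]; this is the underlying
   vector space structure. *)
Definition mscale (k : pzRingType) (A : pzAlgType k) (M : lmodType A)
  (c : k) (m : M) : M := ascale c (1 : A) *: m.

Definition subspace (k : pzRingType) (V : zmodType) (scale : k -> V -> V)
    (W : {pred V}) : Prop :=
  0 \in W /\ (forall c u v, u \in W -> v \in W -> scale c u + v \in W).

(* Every vector is the sum of a unique finitely supported family of vectors
   [f@_i \in W i]. *)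
Definition direct_sum (I : choiceType) (V : zmodType) (W : I -> {pred V}) :=
  forall v, exists! f : {malg V[I]},
    (forall i, f@_i \in W i) /\ v = \sum_(i <- msupp f) f@_i.

Record grading (O : choiceType) (G : groupoid O) (k : fieldType)
    (A : pzAlgType k) := Grading {
  gr :> G -> {pred A};
  gr_subspace : forall g, subspace (@ascale k A) (gr g);
  gr_direct : direct_sum gr;
  grM : forall g h, dom g = rng h ->
    forall a b, a \in gr g -> b \in gr h -> a * b \in gr (compg g h);
  grM0 : forall g h, dom g != rng h ->
    forall a b, a \in gr g -> b \in gr h -> a * b = 0 }.

Definition is_unit_of (R : pzRingType) (W : {pred R}) (u : R) : Prop :=
  u \in W /\ (forall a, a \in W -> u * a = a /\ a * u = a).

(* The identity element of the subalgebra [W] if it has one, and 0 otherwise.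
   The components [gr (idm G e)] of a graded algebra always have one: see
   [gr_unitP] below. *)
Definition unit_of (R : pzRingType) (W : {pred R}) : R :=
  if pselect (exists u, is_unit_of W u) is left h then sval (cid h) else 0.

Lemma unit_ofE (R : pzRingType) (W : {pred R}) u :
  is_unit_of W u -> unit_of W = u.
Proof.
move=> [uW uP]; rewrite /unit_of; case: pselect => [h|[]]; last by exists u.
case: cid => v /= [vW vP].
by have [_ <-] := uP _ vW; have [-> _] := vP _ uW.
Qed.

Section MalgSum.
Variables (I : choiceType) (V U : zmodType) (F : I -> V -> U).
Hypothesis FD : forall i, {morph F i : a b / a + b}.
Implicit Types f : {malg V[I]}.

Lemma msumF0 i : F i 0 = 0.
Proof. by apply: (addrI (F i 0)); rewrite -FD !addr0. Qed.

Lemma msumw f (D : {fset I}) : (msupp f `<=` D)%fset ->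
  \sum_(i <- msupp f) F i f@_i = \sum_(i <- D) F i f@_i.
Proof.
move=> fD; apply: big_fset_incl => // i iD.
by move/mcoeff_outdom=> ->; rewrite msumF0.
Qed.

Lemma msumD f1 f2 :
  \sum_(i <- msupp (f1 + f2)) F i (f1 + f2)@_i =
  \sum_(i <- msupp f1) F i f1@_i + \sum_(i <- msupp f2) F i f2@_i.
Proof.
rewrite (msumw (msuppD_le f1 f2)) (msumw (fsubsetUl _ (msupp f2))).
rewrite (msumw (fsubsetUr (msupp f1) _)) -big_split /=.
by apply: eq_bigr => i _; rewrite mcoeffD FD.
Qed.

Lemma msumU i v :
  \sum_(j <- msupp << v *g i >>) F j << v *g i >>@_j = F i v.
Proof. by rewrite (msumw msuppU_le) big_seq_fset1 mcoeffUU. Qed.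

Lemma msum0 : \sum_(i <- msupp (0 : {malg V[I]})) F i 0@_i = 0.
Proof. by rewrite msupp0 big_seq_fset0. Qed.

Lemma msum_sum (J : Type) (r : seq J) (P : pred J) (H : J -> {malg V[I]}) :
  \sum_(i <- msupp (\sum_(j <- r | P j) H j)) F i (\sum_(j <- r | P j) H j)@_i
  = \sum_(j <- r | P j) \sum_(i <- msupp (H j)) F i (H j)@_i.
Proof.
exact: (big_morph (fun f : {malg V[I]} => \sum_(i <- msupp f) F i f@_i)
          msumD msum0).
Qed.
End MalgSum.

Section GradingTheory.
Variables (O : choiceType) (G : groupoid O) (k : fieldType).
Variables (A : pzAlgType k) (gA : grading G A).

Lemma ascale0r (c : k) : ascale c (0 : A) = 0.
Proof. by apply: (addrI (ascale c 0)); rewrite -ascaleDr !addr0. Qed.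

Lemma ascale0l (a : A) : ascale (0 : k) a = 0.
Proof. by apply: (addrI (ascale (0 : k) a)); rewrite -ascaleDl !addr0. Qed.

Lemma ascaleN1 (a : A) : ascale (-1 : k) a = - a.
Proof. by apply: (addrI a); rewrite -{1}[a](@ascale1 k) -ascaleDl !subrr ascale0l. Qed.

Lemma gr0 g : 0 \in gA g.
Proof. by have [] := gr_subspace gA g. Qed.

Lemma grB g : {in gA g &, forall a b, a - b \in gA g}.
Proof.
move=> a b ag bg; have [_ h] := gr_subspace gA g.
by have:= h (-1) b a bg ag; rewrite ascaleN1 addrC.
Qed.

Lemma grN g : {in gA g, forall a, - a \in gA g}.
Proof. by move=> a ag; rewrite -sub0r grB ?gr0. Qed.

Lemma grD g : {in gA g &, forall a b, a + b \in gA g}.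
Proof. by move=> a b ag bg; rewrite -[b]opprK grB ?grN. Qed.

Lemma grZ g (c : k) : {in gA g, forall a, ascale c a \in gA g}.
Proof.
move=> a ag; have [h0 h] := gr_subspace gA g.
by have:= h c a 0 ag h0; rewrite addr0.
Qed.

Lemma gr_uniq (f1 f2 : {malg A[G]}) :
  (forall g, f1@_g \in gA g) -> (forall g, f2@_g \in gA g) ->
  \sum_(g <- msupp f1) f1@_g = \sum_(g <- msupp f2) f2@_g -> f1 = f2.
Proof.
move=> h1 h2 e; have [f [_ fu]] := gr_direct gA (\sum_(g <- msupp f1) f1@_g).
by rewrite -(fu f1) // -(fu f2).
Qed.

Lemma gr_sum (J : Type) (r : seq J) (P : pred J) (H : J -> A) g :
  (forall j, P j -> H j \in gA g) -> \sum_(j <- r | P j) H j \in gA g.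
Proof.
move=> h; apply: (big_ind (fun a => a \in gA g)) => //; first exact: gr0.
by move=> *; apply: grD.
Qed.

Lemma grU g a l : a \in gA g -> << a *g g >>@_l \in gA l.
Proof.
by rewrite mcoeffU; case: eqVneq => [<-//|_ _]; rewrite mulr0n gr0.
Qed.

Lemma sum_single (T : choiceType) (D : {fset T}) (P : pred T) (H : T -> A) i :
  P i -> (i \notin D -> H i = 0) ->
  (forall j, j \in D -> P j -> j != i -> H j = 0) ->
  \sum_(j <- D | P j) H j = H i.
Proof.
move=> Pi Hi Hj; rewrite big_mkcond /=; case: (boolP (i \in D)) => iD.
  rewrite (big_fsetD1 i) //= Pi big_seq_cond big1 ?addr0 // => j.
  rewrite in_fsetD1 andbT => /andP[ji jD]; case: ifP => // Pj; exact: Hj.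
rewrite (Hi iD) big_seq_cond big1 // => j /andP[jD _]; case: ifP => // Pj.
by apply: Hj => //; apply: contraNneq iD => <-.
Qed.

Lemma comp_eq_r (g h : G) : dom g = rng h -> compg g h = h -> g = idm G (rng h).
Proof.
move=> gh e; rewrite -[g]compg1 gh -(compgV h).
by rewrite compgA ?e ?rng_inv.
Qed.

Lemma comp_eq_l (g h : G) : dom h = rng g -> compg h g = h -> g = idm G (dom h).
Proof.
move=> gh e; rewrite -[g]comp1g -gh -(compVg h).
by rewrite -compgA ?e ?dom_inv.
Qed.

Lemma gr_unitE : exists u : O -> A,
  (forall e, u e \in gA (idm G e)) /\
  (forall g b, b \in gA g -> u (rng g) * b = b /\ b * u (dom g) = b).
Proof.
have [f [[fP f1] _]] := gr_direct gA 1.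
exists (fun e => f@_(idm G e)); split=> // h b bh; split.
- pose F : {malg A[G]} :=
    \sum_(g <- msupp f | dom g == rng h) << f@_g * b *g compg g h >>.
  have FE : F = << b *g h >>.
    apply: gr_uniq => [g|g|]; last 1 first.
    + rewrite (msum_sum (F := fun _ => id)) // (msumU (F := fun _ => id)) //.
      under eq_bigr do rewrite (msumU (F := fun _ => id)) //.
      rewrite -[RHS]mul1r f1 big_distrl /= [RHS](bigID (fun g => dom g == rng h)).
      by rewrite /= [X in _ = _ + X]big1 ?addr0 // => g gh; apply: (grM0 gh).
    + rewrite raddf_sum; apply: gr_sum => l /eqP lh.
      by apply: grU; apply: grM.
    + exact: grU.
  have := congr1 (mcoeff h) FE; rewrite mcoeffUU raddf_sum /= => E.
  rewrite -[RHS]E (sum_single (i := idm G (rng h))) ?dom_id //.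
  + by rewrite comp1g mcoeffUU.
  + by move=> /mcoeff_outdom->; rewrite mul0r mcoeffU mul0rn.
  move=> g _ /eqP gh gn; rewrite mcoeffU; case: eqP => // e.
  by rewrite (comp_eq_r gh e) eqxx in gn.
- pose F : {malg A[G]} :=
    \sum_(g <- msupp f | dom h == rng g) << b * f@_g *g compg h g >>.
  have FE : F = << b *g h >>.
    apply: gr_uniq => [g|g|]; last 1 first.
    + rewrite (msum_sum (F := fun _ => id)) // (msumU (F := fun _ => id)) //.
      under eq_bigr do rewrite (msumU (F := fun _ => id)) //.
      rewrite -[RHS]mulr1 f1 big_distrr /= [RHS](bigID (fun g => dom h == rng g)).
      by rewrite /= [X in _ = _ + X]big1 ?addr0 // => g gh; exact: (grM0 gh bh (fP g)).
    + rewrite raddf_sum; apply: gr_sum => l /eqP lh.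
      by apply: grU; apply: grM.
    + exact: grU.
  have := congr1 (mcoeff h) FE; rewrite mcoeffUU raddf_sum /= => E.
  rewrite -[RHS]E (sum_single (i := idm G (dom h))) ?rng_id //.
  + by rewrite compg1 mcoeffUU.
  + by move=> /mcoeff_outdom->; rewrite mulr0 mcoeffU mul0rn.
  move=> g _ /eqP gh gn; rewrite mcoeffU; case: eqP => // e.
  by rewrite (comp_eq_l gh e) eqxx in gn.
Qed.

Definition gr_unit (e : O) : A := unit_of (gA (idm G e)).

Lemma gr_unitP e : is_unit_of (gA (idm G e)) (gr_unit e).
Proof.
have [u [uA uP]] := gr_unitE.
have h : is_unit_of (gA (idm G e)) (u e).
  by split=> // a /uP; rewrite rng_id dom_id.
by rewrite /gr_unit (unit_ofE h).
Qed.

Lemma gr_mul_unit g b : b \in gA g ->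
  gr_unit (rng g) * b = b /\ b * gr_unit (dom g) = b.
Proof.
have [u [uA uP]] := gr_unitE.
suff -> : gr_unit = u by exact: uP.
apply: funext => e; apply: unit_ofE; split=> // a /uP.
by rewrite rng_id dom_id.
Qed.

End GradingTheory.

Section Smash.
Variables (O : finType) (G : groupoid O) (X : finType) (al : action G X).
Variables (k : fieldType) (A : pzAlgType k) (gA : grading G A).

(* A family [f] indexed by [G * X] stands for the sum of the [f@_(g, x) delta_x];
   the smash product consists of the finitely supported families such that
   [f@_(g, x)] is in [gA g] and vanishes if [x] is not in X_{dom g}. *)
Definition smash_pred (f : {malg A[(G * X)%type]}) : bool :=
  all (fun p => (f@_p \in gA p.1) && (p.2 \in act_set al (idm G (dom p.1))))
      (msupp f).

Record smash := Smash {
  smash_val : {malg A[(G * X)%type]};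
  smash_valP : smash_pred smash_val }.

HB.instance Definition _ := [isSub for smash_val].
HB.instance Definition _ := [Choice of smash by <:].

Lemma smash_predP f : reflect
  (forall p, f@_p \in gA p.1 /\
    (p.2 \notin act_set al (idm G (dom p.1)) -> f@_p = 0)) (smash_pred f).
Proof.
apply: (iffP allP) => h p.
  have [/h/andP[]|_] := msuppP; last by rewrite gr0.
  by move=> -> ->.
have [fp px] := h p; rewrite -mcoeff_neq0 => f0; rewrite fp /=.
by apply: contraNT f0 => /px ->.
Qed.

Fact smash_zmod_closed : zmod_closed smash_pred.
Proof.
split; first by apply/smash_predP => p; rewrite mcoeff0 gr0.
move=> f g /smash_predP hf /smash_predP hg; apply/smash_predP => p.
have [f1 f2] := hf p; have [g1 g2] := hg p.
by rewrite mcoeffB grB //; split=> // px; rewrite f2 // g2 // subr0.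
Qed.
HB.instance Definition _ := GRing.isZmodClosed.Build _ smash_pred smash_zmod_closed.
HB.instance Definition _ := [SubChoice_isSubZmodule of smash by <:].

(* The product [(a delta_x)(b delta_y)] for [p = (g, x)], [q = (h, y)] *)
Definition delta_mul (p q : G * X) (a b : A) : {malg A[(G * X)%type]} :=
  if (dom p.1 == rng q.1) && (al q.1 q.2 == p.2)
  then << a * b *g (compg p.1 q.1, q.2) >> else 0.

Definition smash_mul_val (f f' : {malg A[(G * X)%type]}) :=
  \sum_(p <- msupp f) \sum_(q <- msupp f') delta_mul p q f@_p f'@_q.

Definition smash_one_val : {malg A[(G * X)%type]} :=
  \sum_(e : O) \sum_(x in act_set al (idm G e)) << gr_unit gA e *g (idm G e, x) >>.

Definition smash_scale_val (c : k) (f : {malg A[(G * X)%type]}) :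
    {malg A[(G * X)%type]} := [malg p in msupp f => ascale c f@_p].

Lemma delta_mulDl p q b : {morph (fun a => delta_mul p q a b) : a a' / a + a'}.
Proof.
by move=> a a'; rewrite /delta_mul; case: ifP => _; rewrite ?addr0 // mulrDl raddfD.
Qed.

Lemma delta_mulDr p q a : {morph (fun b => delta_mul p q a b) : b b' / b + b'}.
Proof.
by move=> b b'; rewrite /delta_mul; case: ifP => _; rewrite ?addr0 // mulrDr raddfD.
Qed.

Lemma smash_mul_valDl f' :
  {morph (fun f => smash_mul_val f f') : f1 f2 / f1 + f2}.
Proof.
move=> f1 f2; rewrite /smash_mul_val.
apply: (msumD (F := fun p a => \sum_(q <- msupp f') delta_mul p q a f'@_q)) => p.
by move=> a a'; rewrite -big_split; apply: eq_bigr => l _; apply: delta_mulDl.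
Qed.

Lemma smash_mul_valDr f :
  {morph (fun f' => smash_mul_val f f') : f1 f2 / f1 + f2}.
Proof.
move=> f1 f2; rewrite /smash_mul_val -big_split; apply: eq_bigr => p _ /=.
apply: (msumD (F := fun q b => delta_mul p q f@_p b)) => q.
exact: delta_mulDr.
Qed.

Lemma smash_mul_val0 f : smash_mul_val f 0 = 0.
Proof.
by apply: (addrI (smash_mul_val f 0)); rewrite -smash_mul_valDr !addr0.
Qed.

Lemma smash_mul_0val f : smash_mul_val 0 f = 0.
Proof.
by apply: (addrI (smash_mul_val 0 f)); rewrite -smash_mul_valDl !addr0.
Qed.

Lemma smash_mul_valU p q a b :
  smash_mul_val << a *g p >> << b *g q >> = delta_mul p q a b.
Proof.
rewrite /smash_mul_val.
rewrite (msumU (F := fun p a => \sum_(l <- _) delta_mul p l a _@_l)) => [|{}p].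
  by rewrite (msumU (F := fun q b => delta_mul p q a b)) => // l; apply: delta_mulDr.
by move=> c d; rewrite -big_split; apply: eq_bigr => l _; apply: delta_mulDl.
Qed.

Lemma smash_mul_suml (J : Type) (r : seq J) (P : pred J) H f :
  smash_mul_val (\sum_(j <- r | P j) H j) f =
  \sum_(j <- r | P j) smash_mul_val (H j) f.
Proof.
exact: (big_morph (fun g => smash_mul_val g f) (smash_mul_valDl f)
          (smash_mul_0val f)).
Qed.

Lemma smash_mul_sumr (J : Type) (r : seq J) (P : pred J) H f :
  smash_mul_val f (\sum_(j <- r | P j) H j) =
  \sum_(j <- r | P j) smash_mul_val f (H j).
Proof.
exact: (big_morph (fun g => smash_mul_val f g) (smash_mul_valDr f)
          (smash_mul_val0 f)).
Qed.

Lemma smash_pred_sum (J : Type) (r : seq J) (P : pred J) H :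
  (forall j, P j -> smash_pred (H j)) -> smash_pred (\sum_(j <- r | P j) H j).
Proof.
have [h0 hB] := smash_zmod_closed; have h0' : smash_pred 0 by exact: h0.
move=> h; elim/big_rec: _ => // j f Pj hf; rewrite -[H j]opprK addrC.
by apply: (hB) => //; rewrite unfold_in -sub0r; apply: (hB) => //; apply: h.
Qed.

Lemma smash_predU a p :
  a \in gA p.1 -> p.2 \in act_set al (idm G (dom p.1)) -> smash_pred << a *g p >>.
Proof.
move=> ap px; apply/smash_predP => q; rewrite mcoeffU.
by case: eqVneq => [<-|_]; rewrite ?gr0 //= px.
Qed.

Lemma smash_mul_closed f f' :
  smash_pred f -> smash_pred f' -> smash_pred (smash_mul_val f f').
Proof.
move=> /allP hf /allP hf'; rewrite /smash_mul_val big_seq.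
apply: smash_pred_sum => p /hf/andP[fp px].
rewrite big_seq; apply: smash_pred_sum => q /hf'/andP[fq qx].
rewrite /delta_mul; case: ifP => [/andP[/eqP pq _]|_]; last by have [] := smash_zmod_closed.
by apply: smash_predU => /=; [apply: grM | rewrite dom_comp].
Qed.

Lemma smash_one_closed : smash_pred smash_one_val.
Proof.
apply: smash_pred_sum => e _; apply: smash_pred_sum => x xe.
by apply: smash_predU => /=; rewrite ?dom_id //; have [] := gr_unitP gA e.
Qed.

Lemma smash_scaleE c f p : (smash_scale_val c f)@_p = ascale c f@_p.
Proof.
by rewrite mcoeffE; case: (msuppP f p) => //; rewrite ascale0r.
Qed.

Lemma smash_scale_closed c f : smash_pred f -> smash_pred (smash_scale_val c f).
Proof.
move=> /smash_predP h; apply/smash_predP => p; have [fp px] := h p.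
by rewrite smash_scaleE; split=> [|/px->]; [apply: grZ | rewrite ascale0r].
Qed.

Lemma smash_mul_valA f1 f2 f3 :
  smash_pred f1 -> smash_pred f2 -> smash_pred f3 ->
  smash_mul_val f1 (smash_mul_val f2 f3) = smash_mul_val (smash_mul_val f1 f2) f3.
Proof.
move=> _ _ /allP h3; rewrite [f1]monalgE [f2]monalgE [f3]monalgE.
have suml := smash_mul_suml; have sumr := smash_mul_sumr.
have mU := smash_mul_valU; have m0 := smash_mul_val0; have m0l := smash_mul_0val.
move: smash_mul_val suml sumr mU m0 m0l => m suml sumr mU m0 m0l.
rewrite !suml; apply: eq_bigr => p _.
rewrite 2![m << _ *g p >> (\sum_(j <- msupp f2) _)]sumr suml.
apply: eq_bigr => q _; rewrite !sumr; apply: eq_big_seq => l /h3/andP[_ lx].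
rewrite !mU /delta_mul.
case: (boolP ((dom q.1 == _) && _)) => [/andP[/eqP ql /eqP lq]|nql]; last first.
  rewrite m0; case: ifP => [/andP[/eqP pq _]|_]; last by rewrite m0l.
  by rewrite mU /delta_mul /= dom_comp // (negbTE nql).
rewrite mU /delta_mul /= rng_comp // -act_comp //; last first.
  by rewrite act_set_rng rng_inv.
rewrite lq; case: ifP => [/andP[/eqP pq _]|_]; last by rewrite m0l.
by rewrite mU /delta_mul /= dom_comp // ql lq !eqxx /= mulrA compgA.
Qed.

Lemma smash_one_mulE p a : a \in gA p.1 ->
  p.2 \in act_set al (idm G (dom p.1)) ->
  smash_mul_val smash_one_val << a *g p >> = << a *g p >>.
Proof.
case: p => g x /= ag xg; rewrite smash_mul_suml.
have xinv : x \in act_set al (invm g) by rewrite act_set_rng rng_inv.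
have alx : al g x \in act_set al (idm G (rng g)).
  by rewrite -act_set_rng -act_img imset_f.
rewrite (bigD1 (rng g)) //= [X in _ + X]big1 ?addr0 => [|e /negbTE er].
  rewrite smash_mul_suml (bigD1 (al g x)) //= [X in _ + X]big1 ?addr0 => [|y].
    rewrite smash_mul_valU /delta_mul /= dom_id !eqxx comp1g.
    by have [-> _] := gr_mul_unit ag.
  move=> /andP[_ /negbTE yx].
  by rewrite smash_mul_valU /delta_mul /= [al g x == _]eq_sym yx andbF.
rewrite smash_mul_suml big1 // => y _.
by rewrite smash_mul_valU /delta_mul /= dom_id er.
Qed.

Lemma smash_mul_oneE p a : a \in gA p.1 ->
  p.2 \in act_set al (idm G (dom p.1)) ->
  smash_mul_val << a *g p >> smash_one_val = << a *g p >>.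
Proof.
case: p => g x /= ag xg; rewrite smash_mul_sumr.
rewrite (bigD1 (dom g)) //= [X in _ + X]big1 ?addr0 => [|e /negbTE er].
  rewrite smash_mul_sumr (bigD1 x) //= [X in _ + X]big1 ?addr0 => [|y].
    rewrite smash_mul_valU /delta_mul /= rng_id act_id // !eqxx compg1.
    by have [_ ->] := gr_mul_unit ag.
  move=> /andP[yg /negbTE yx].
  by rewrite smash_mul_valU /delta_mul /= act_id // yx andbF.
rewrite smash_mul_sumr big1 // => y _.
by rewrite smash_mul_valU /delta_mul /= rng_id eq_sym er.
Qed.

Lemma smash_one_mul_val f : smash_pred f -> smash_mul_val smash_one_val f = f.
Proof.
move=> /allP h; rewrite {1}[f]monalgE smash_mul_sumr [RHS]monalgE.
by apply: eq_big_seq => p /h /andP[fp px]; apply: smash_one_mulE.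
Qed.

Lemma smash_mul_one_val f : smash_pred f -> smash_mul_val f smash_one_val = f.
Proof.
move=> /allP h; rewrite {1}[f]monalgE smash_mul_suml [RHS]monalgE.
by apply: eq_big_seq => p /h /andP[fp px]; apply: smash_mul_oneE.
Qed.

Lemma smash_scaleD c : {morph smash_scale_val c : f f' / f + f'}.
Proof.
by move=> f f'; apply/malgP => p; rewrite !(mcoeffD, smash_scaleE) ascaleDr.
Qed.

Lemma smash_scale_sum c (J : Type) (r : seq J) (P : pred J) H :
  smash_scale_val c (\sum_(j <- r | P j) H j) =
  \sum_(j <- r | P j) smash_scale_val c (H j).
Proof.
apply: (big_morph _ (smash_scaleD c)).
by apply: (addrI (smash_scale_val c 0)); rewrite -smash_scaleD !addr0.
Qed.

Lemma smash_scaleU c a p : smash_scale_val c << a *g p >> = << ascale c a *g p >>.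
Proof.
apply/malgP => q; rewrite smash_scaleE !mcoeffU; case: eqP => // _.
by rewrite !mulr0n ascale0r.
Qed.

Lemma smash_scale_mul c f f' :
  smash_scale_val c (smash_mul_val f f') = smash_mul_val (smash_scale_val c f) f'
  /\ smash_scale_val c (smash_mul_val f f') = smash_mul_val f (smash_scale_val c f').
Proof.
rewrite [f]monalgE [f']monalgE.
have suml := smash_mul_suml; have sumr := smash_mul_sumr.
have mU := smash_mul_valU.
have s0 : smash_scale_val c 0 = 0.
  by apply: (addrI (smash_scale_val c 0)); rewrite -smash_scaleD !addr0.
move: smash_mul_val suml sumr mU => m suml sumr mU.
rewrite !(suml, smash_scale_sum); split; apply: eq_bigr => p _.
  rewrite !(sumr, smash_scale_sum); apply: eq_bigr => q _.
  by rewrite smash_scaleU !mU /delta_mul; case: ifP => // _; rewrite smash_scaleU ascaleAl.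
rewrite !(sumr, smash_scale_sum); apply: eq_bigr => q _.
by rewrite smash_scaleU !mU /delta_mul; case: ifP => // _; rewrite smash_scaleU ascaleAr.
Qed.

Definition smash_one : smash := Smash smash_one_closed.

Definition smash_mul (u v : smash) : smash :=
  Smash (smash_mul_closed (smash_valP u) (smash_valP v)).

Definition smash_scale (c : k) (u : smash) : smash :=
  Smash (smash_scale_closed c (smash_valP u)).

Fact smash_mulA : associative smash_mul.
Proof. by move=> u v w; apply: val_inj; apply: smash_mul_valA; apply: smash_valP. Qed.

Fact smash_mul1 : left_id smash_one smash_mul.
Proof. by move=> u; apply: val_inj; apply: smash_one_mul_val; apply: smash_valP. Qed.

Fact smash_1mul : right_id smash_one smash_mul.
Proof. by move=> u; apply: val_inj; apply: smash_mul_one_val; apply: smash_valP. Qed.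

Fact smash_mulDl : left_distributive smash_mul +%R.
Proof. by move=> u v w; apply: val_inj; apply: smash_mul_valDl. Qed.

Fact smash_mulDr : right_distributive smash_mul +%R.
Proof. by move=> u v w; apply: val_inj; apply: smash_mul_valDr. Qed.

HB.instance Definition _ := GRing.Zmodule_isPzRing.Build smash
  smash_mulA smash_mul1 smash_1mul smash_mulDl smash_mulDr.

Fact smash_scaleA c d u : smash_scale c (smash_scale d u) = smash_scale (c * d) u.
Proof.
by apply: val_inj; apply/malgP => p; rewrite !smash_scaleE ascaleA.
Qed.

Fact smash_scale1 u : smash_scale 1 u = u.
Proof. by apply: val_inj; apply/malgP => p; rewrite smash_scaleE ascale1. Qed.

Fact smash_scaleDr c (u v : smash) :
  smash_scale c (u + v) = smash_scale c u + smash_scale c v.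
Proof. by apply: val_inj; apply: smash_scaleD. Qed.

Fact smash_scaleDl u c d : smash_scale (c + d) u = smash_scale c u + smash_scale d u.
Proof.
apply: val_inj; apply/malgP => p.
by rewrite /= mcoeffD !smash_scaleE ascaleDl.
Qed.

Fact smash_scaleAl c (u v : smash) : smash_scale c (u * v) = smash_scale c u * v.
Proof. by apply: val_inj; have [] := smash_scale_mul c (smash_val u) (smash_val v). Qed.

Fact smash_scaleAr c (u v : smash) : smash_scale c (u * v) = u * smash_scale c v.
Proof. by apply: val_inj; have [] := smash_scale_mul c (smash_val u) (smash_val v). Qed.

HB.instance Definition _ := isPzAlgebra.Build k smash
  smash_scaleA smash_scale1 smash_scaleDr smash_scaleDl smash_scaleAl smash_scaleAr.

End Smash.

Section ModuleCategory.
Variable B : pzRingType.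

Lemma linear_inj (M N : lmodType B) (f g : {linear M -> N}) : f =1 g -> f = g.
Proof.
case: f g => [f [[f1] [f2]]] [g [[g1] [g2]]] /= /funext fg.
case: g / fg g1 g2 => g1 g2.
by rewrite (Prop_irrelevance f1 g1) (Prop_irrelevance f2 g2).
Qed.

Definition lin_id (M : lmodType B) : {linear M -> M} := idfun.

Definition lin_comp (M N P : lmodType B) (f : {linear N -> P})
  (g : {linear M -> N}) : {linear M -> P} := f \o g.

Fact lin_comp1f (M N : lmodType B) (f : {linear M -> N}) :
  lin_comp (lin_id N) f = f.
Proof. exact: linear_inj. Qed.

Fact lin_compf1 (M N : lmodType B) (f : {linear M -> N}) :
  lin_comp f (lin_id M) = f.
Proof. exact: linear_inj. Qed.

Fact lin_compA (M N P Q : lmodType B) (f : {linear P -> Q})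
    (g : {linear N -> P}) (h : {linear M -> N}) :
  lin_comp f (lin_comp g h) = lin_comp (lin_comp f g) h.
Proof. exact: linear_inj. Qed.

Definition module_category : category :=
  @Category (lmodType B) (fun M N => {linear M -> N}) lin_id lin_comp
    lin_comp1f lin_compf1 lin_compA.

End ModuleCategory.

Section GradedModules.
Variables (O : choiceType) (G : groupoid O) (X : finType) (al : action G X).
Variables (k : fieldType) (A : pzAlgType k) (gA : grading G A).

Record graded_module := GradedModule {
  gm_sort :> lmodType A;
  gm_part : X -> {pred gm_sort};
  gm_subspace : forall x, subspace (@mscale k A gm_sort) (gm_part x);
  gm_direct : direct_sum gm_part;
  gm_act : forall g x, x \in act_set al (idm G (dom g)) ->
    forall a m, a \in gA g -> m \in gm_part x -> a *: m \in gm_part (al g x);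
  gm_act0 : forall g x, x \notin act_set al (idm G (dom g)) ->
    forall a m, a \in gA g -> m \in gm_part x -> a *: m = 0 }.

Arguments gm_part M x : clear implicits, rename.

Definition graded_hom (M N : graded_module) : Type :=
  {f : {linear M -> N} | forall x m, m \in gm_part M x -> f m \in gm_part N x}.

Fact graded_id_subproof (M : graded_module) x m :
  m \in gm_part M x -> lin_id M m \in gm_part M x.
Proof. by []. Qed.

Definition graded_id (M : graded_module) : graded_hom M M :=
  exist _ (lin_id M) (@graded_id_subproof M).

Fact graded_comp_subproof (M N P : graded_module)
    (f : graded_hom N P) (g : graded_hom M N) x m :
  m \in gm_part M x -> lin_comp (sval f) (sval g) m \in gm_part P x.
Proof. by move=> h; apply: (svalP f); apply: (svalP g). Qed.

Definition graded_comp (M N P : graded_module)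
    (f : graded_hom N P) (g : graded_hom M N) : graded_hom M P :=
  exist _ (lin_comp (sval f) (sval g)) (graded_comp_subproof f g).

Lemma graded_hom_inj (M N : graded_module) (f g : graded_hom M N) :
  sval f =1 sval g -> f = g.
Proof. by case: f g => [f fP] [g gP] /= /linear_inj; apply: eq_exist. Qed.

Fact graded_comp1f (M N : graded_module) (f : graded_hom M N) :
  graded_comp (graded_id N) f = f.
Proof. exact: graded_hom_inj. Qed.

Fact graded_compf1 (M N : graded_module) (f : graded_hom M N) :
  graded_comp f (graded_id M) = f.
Proof. exact: graded_hom_inj. Qed.

Fact graded_compA (M N P Q : graded_module) (f : graded_hom P Q)
    (g : graded_hom N P) (h : graded_hom M N) :
  graded_comp f (graded_comp g h) = graded_comp (graded_comp f g) h.
Proof. exact: graded_hom_inj. Qed.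

Definition graded_module_category : category :=
  @Category graded_module graded_hom graded_id graded_comp
    graded_comp1f graded_compf1 graded_compA.

End GradedModules.

Arguments gm_part {O G X al k A gA} M x : rename.

(* Main.v *)
Require Import Defs.
From HB Require Import structures.
From mathcomp Require Import all_boot all_order all_algebra.
From mathcomp Require Import finmap boolp.
From mathcomp.multinomials Require Import monalg.
Set Implicit Arguments.
Unset Strict Implicit.
Unset Printing Implicit Defensive.
Import GRing.Theory.
Local Open Scope ring_scope.

(** The objects of both categories are abelian groups with the same additional
    structure in two presentations, and the two functors only change the
    presentation.

    Write [delta g x a] for the element [a_g delta_x] of the smash product [S],
    where [a_g] is the component of degree [g] of [a]. There are two ingredients
    in [S]: the elements [eps x = \sum_e 1_e delta_x], which are orthogonal
    idempotents with sum 1 ([eps_eps], [sum_eps]), and the map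
    [eta a = \sum_g \sum_x a_g delta_x], which is a unital ring morphism from
    [A] to [S] ([eta1], [etaM]). Their products span [S], because
    [eta a * eps x = a delta_x] for [a] homogeneous ([eta_eps]).

    Given an [X]-graded [A]-module [M], the element [a delta_x] acts on [M] as
    the projection to [M_x] followed by [a] ([sact]); the compatibility of the
    grading with the action of the groupoid is what makes this associative
    ([sactA]). Conversely, an [S]-module becomes an [A]-module by restriction
    of scalars along [eta], and it is graded by the images of the idempotents
    [eps x] ([of_smash]). The two constructions are inverse to each other since
    [eps x] acts as the projection to [M_x], and [eta a] as [a]. A map is
    [S]-linear iff it is [A]-linear and commutes with the idempotents, that is,
    iff it is a morphism of graded modules, so that both functors leave the
    underlying maps unchanged.

    The isomorphism is an equality of functors, hence of modules as structures.
    The functors therefore replace the scalar multiplication of a module and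
    keep all its other fields ([rescale]): going back and forth restores the
    module exactly ([rescale_id]), and the transport along the resulting
    equality of modules is the identity on elements, by proof irrelevance,
    because the carrier has never changed ([recast_rescale]). *)

(** * Equality of functors and of modules *)

Definition eq_hom (C : category) (a b : C) (E : a = b) : Defs.hom a b :=
  eq_rect a (Defs.hom a) (idc a) b E.

(** The identities of [C], transported along [E], form a natural isomorphism
    from [H] to the identity functor; naturality is the equality of the
    morphism parts, stated without casts between hom types. *)
Lemma functor_eq_id (C : category) (H : functor C C) (E : forall a, H a = a) :
  (forall a b (f : Defs.hom a b),
     compc (eq_hom (E b)) (fhom H f) = compc f (eq_hom (E a))) ->
  H = functor_id C.
Proof.
case: H E => o h h1 hM /= E; have oE : o = id by apply: funext => a; exact: E.
subst o => /= hE; have {}hE a b (f : Defs.hom a b) : h a b f = f.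
  have := hE a b f; rewrite (Prop_irrelevance (E b) erefl).
  by rewrite (Prop_irrelevance (E a) erefl) /= comp1c compc1.
have {}hE : h = fun _ _ f => f by do 3!apply: functional_extensionality_dep => ?.
subst h; rewrite /functor_id.
rewrite (Prop_irrelevance h1 (fun _ => erefl)).
by rewrite (Prop_irrelevance hM (fun _ _ _ _ _ => erefl)).
Qed.

Section Rescaling.
Variables (R : pzRingType) (Z : zmodType) (s : R -> Z -> Z).
Hypothesis sA : forall a b v, s a (s b v) = s (a * b) v.
Hypothesis s1 : left_id 1 s.
Hypothesis sDr : right_distributive s +%R.
Hypothesis sDl : forall v, {morph s^~ v : a b / a + b}.

Fact rescale_s0 v : s 0 v = 0.
Proof. by apply: (addIr (s 0 v)); rewrite -sDl !add0r. Qed.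

(** All the fields of the result other than the scalar multiplication and its
    laws are projections of [Z]. Applied to a module, this makes every operation
    but the scaling convertible to the original one, as [rescale_id] requires. *)
Definition rescale : lmodType R :=
  GRing.Lmodule.Pack (GRing.Lmodule.Class
    (Algebra.Zmodule.Algebra_BaseZmoduleNmodule_isZmodule_mixin
       (GRing.Zmodule.class Z))
    (GRing.Nmodule_isLSemiModule.Build R Z sA rescale_s0 s1 sDr sDl)).
End Rescaling.

(** A module is determined by its additive group and its scaling, since the
    remaining fields are propositions. *)
Lemma rescale_id (R : pzRingType) (M : lmodType R) s sA s1 sDr sDl :
  (forall a m, s a m = a *: m) -> @rescale R M s sA s1 sDr sDl = M.
Proof.
move=> sE; have {}sE : s = *:%R by apply: funext => a; apply: funext.
subst s.
case: M sA s1 sDr sDl => T c sA s1 sDr sDl.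
rewrite /rescale /=; congr (GRing.Lmodule.Pack _).
case: c sA s1 sDr sDl => ? ? ? ? ? ? ? ? ? [s] a b c d e sA s1 sDr sDl.
congr (GRing.Lmodule.Class _ _).
congr (GRing.Nmodule_isLSemiModule.Axioms_ _ _ _ _ _ _); exact: Prop_irrelevance.
Qed.

Definition recast (R : pzRingType) (M N : lmodType R) (E : M = N) (m : M) : N :=
  eq_rect M (fun L : lmodType R => L) m N E.

Lemma recastE (R : pzRingType) (M N : lmodType R) (E : M = N) m :
  recast E m = eq_rect (M : Type) id m N (f_equal (@GRing.Lmodule.sort R) E).
Proof. by case: N / E. Qed.

(** By [recastE], the transport only depends on the induced equality between
    the carriers. These are convertible here, so that this equality is
    [erefl] by proof irrelevance. *)
Lemma recast_rescale (R : pzRingType) (M : lmodType R) s sA s1 sDr sDl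
    (E : @rescale R M s sA s1 sDr sDl = M) m : recast E m = m.
Proof.
rewrite recastE.
have -> // : f_equal (@GRing.Lmodule.sort R) E = erefl (M : Type).
exact: Prop_irrelevance.
Qed.

Lemma eq_hom_module (R : pzRingType) (M N : module_category R) (E : M = N) :
  eq_hom E =1 recast E :> (M -> N).
Proof. by case: N / E. Qed.

Section GradedModuleEq.
Variables (O : choiceType) (G : groupoid O) (X : finType) (al : action G X).
Variables (k : fieldType) (A : pzAlgType k) (gA : grading G A).
Local Notation grmod := (graded_module al gA).

Lemma graded_module_eq (M N : grmod) (E : M = N :> lmodType A) :
  (forall x m, (m \in gm_part M x) = (recast E m \in gm_part N x)) -> M = N.
Proof.
case: M N E => M pM sM dM aM a0M [N pN sN dN aN a0N] /= E.
case: N / E pN sN dN aN a0N => pN sN dN aN a0N /= pE.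
have {}pE : pM = pN by apply: funext => x; apply: funext => m; exact: pE.
subst pN; congr GradedModule; exact: Prop_irrelevance.
Qed.

Lemma eq_hom_graded (M N : graded_module_category al gA) (E : M = N) m :
  sval (eq_hom E) m = recast (f_equal (@gm_sort _ _ _ _ _ _ _) E) m.
Proof. by case: N / E. Qed.
End GradedModuleEq.

(** * Direct sums over a finite index set *)

Section FiniteDirectSum.
Variables (I : finType) (V : zmodType) (W : I -> {pred V}).

Lemma msum_fin (U : zmodType) (F : I -> V -> U) (f : {malg V[I]}) :
  (forall i, F i 0 = 0) -> \sum_(i <- msupp f) F i f@_i = \sum_i F i f@_i.
Proof.
move=> F0; rewrite big_uniq ?fset_uniq // big_mkcond; apply: eq_bigr => i _.
by case: ifPn => // /mcoeff_outdom->.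
Qed.

Definition fin_malg (c : I -> V) : {malg V[I]} :=
  \sum_i << c i *g i >>.

Lemma mcoeff_fin_malg c i : (fin_malg c)@_i = c i.
Proof.
rewrite raddf_sum (bigD1 i) //= mcoeffUU big1 ?addr0 // => j /negbTE ji.
by rewrite mcoeffU ji.
Qed.

(** A complete system of orthogonal idempotents decomposes [V] into the direct
    sum of its images. *)
Lemma direct_sum_proj (p : I -> V -> V) :
  (forall i, {morph p i : v w / v + w}) ->
  (forall v, \sum_i p i v = v) ->
  (forall i j v, p i (p j v) = if i == j then p j v else 0) ->
  (forall i v, (v \in W i) = (p i v == v)) ->
  direct_sum W.
Proof.
move=> pD p1 pp WE v; have p0 i : p i 0 = 0 by apply: msumF0.
exists (fin_malg (p^~ v)); split.
  split=> [i|]; first by rewrite mcoeff_fin_malg WE pp eqxx.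
  by rewrite (msum_fin (F := fun _ => id)) //;
    under eq_bigr do rewrite mcoeff_fin_malg.
move=> f [fW vE]; apply/malgP => i; rewrite mcoeff_fin_malg.
rewrite vE (msum_fin (F := fun _ => id)) // (big_morph _ (pD i) (p0 i)).
rewrite (bigD1 i) //= big1 ?addr0 => [|j /negbTE ji].
  by apply/eqP; rewrite -WE.
by have /eqP <- := etrans (esym (WE j _)) (fW j); rewrite pp eq_sym ji.
Qed.

Hypothesis dW : direct_sum W.

Definition component (i : I) (v : V) : V := (sval (cid (dW v)))@_i.

Lemma component_in i v : component i v \in W i.
Proof. by rewrite /component; case: cid => f /= [[fW _] _]. Qed.

Lemma sum_component v : \sum_i component i v = v.
Proof.
rewrite /component; case: cid => f /= [[_ fv] _].
by rewrite [RHS]fv (msum_fin (F := fun _ => id)).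
Qed.

Lemma component_uniq (c : I -> V) i :
  (forall j, c j \in W j) -> component i (\sum_j c j) = c i.
Proof.
move=> cW; rewrite /component; case: cid => f /= [_ fu].
rewrite (fu (fin_malg c)) ?mcoeff_fin_malg //; split=> [j|].
  by rewrite mcoeff_fin_malg.
by rewrite (msum_fin (F := fun _ => id)) //;
  under [RHS]eq_bigr do rewrite mcoeff_fin_malg.
Qed.

Hypothesis W0 : forall i, 0 \in W i.
Hypothesis WD : forall i, {in W i &, forall v w, v + w \in W i}.

Lemma componentD i : {morph component i : v w / v + w}.
Proof.
move=> v w; rewrite -{1}[v]sum_component -{1}[w]sum_component -big_split /=.
by rewrite component_uniq // => j; rewrite WD ?component_in.
Qed.

Lemma component_id i j v : v \in W j -> component i v = if i == j then v else 0.
Proof.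
move=> vW; rewrite -(component_uniq (c := fun l => if l == j then v else 0)).
  by rewrite -big_mkcond big_pred1_eq.
by move=> l; case: eqP => // ->.
Qed.

Lemma mem_component i v : (v \in W i) = (component i v == v).
Proof.
apply/idP/eqP => [/component_id->|<-]; first by rewrite eqxx.
exact: component_in.
Qed.
End FiniteDirectSum.

(** * Homogeneous components in a graded algebra *)

Section HomogeneousComponents.
Variables (O : choiceType) (G : groupoid O) (k : fieldType).
Variables (A : pzAlgType k) (gA : grading G A).

Definition hcomp (a : A) : {malg A[G]} := sval (cid (gr_direct gA a)).

Lemma hcomp_gr a g : (hcomp a)@_g \in gA g.
Proof. by rewrite /hcomp; case: cid => f /= [[]]. Qed.

Lemma sum_hcomp a : a = \sum_(g <- msupp (hcomp a)) (hcomp a)@_g.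
Proof. by rewrite /hcomp; case: cid => f /= [[]]. Qed.

Lemma hcompD : {morph hcomp : a b / a + b}.
Proof.
move=> a b; apply: (gr_uniq (gA := gA)) => [g|g|]; first exact: hcomp_gr.
  by rewrite mcoeffD grD ?hcomp_gr.
by rewrite -sum_hcomp (msumD (F := fun _ => id)) // -!sum_hcomp.
Qed.

Lemma hcomp_homog g a : a \in gA g -> hcomp a = << a *g g >>.
Proof.
move=> ag; apply: (gr_uniq (gA := gA)) => [h|h|]; first exact: hcomp_gr.
  exact: grU.
by rewrite -sum_hcomp (msumU (F := fun _ => id)).
Qed.

Lemma gr_ind (P : A -> Prop) :
  P 0 -> (forall a b, P a -> P b -> P (a + b)) ->
  (forall g a, a \in gA g -> P a) -> forall a, P a.
Proof.
move=> P0 PD Pg a; rewrite [a]sum_hcomp; apply: (big_ind P) => // g _.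
exact: (Pg g _ (hcomp_gr a g)).
Qed.
End HomogeneousComponents.

(** The sum is a left identity: on a homogeneous element of degree [g], the
    identity at [rng g] acts trivially and all the others act as zero. *)
Lemma sum_gr_unit (O : finType) (G : groupoid O) (k : fieldType)
    (A : pzAlgType k) (gA : grading G A) : \sum_e gr_unit gA e = 1.
Proof.
rewrite -[LHS]mulr1; move: 1; apply: (gr_ind (gA := gA)) => [|a b|g a ag].
- exact: mulr0.
- by rewrite mulrDr => -> ->.
rewrite mulr_suml (bigD1 (rng g)) //= big1 ?addr0 => [|e er].
  by have [] := gr_mul_unit ag.
have [eA _] := gr_unitP gA e.
by apply: (grM0 _ eA ag); rewrite dom_id.
Qed.

(** * Idempotents of the smash product and the embedding of the algebra *)

Section SmashElements.
Variables (O : finType) (G : groupoid O) (X : finType) (al : action G X).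
Variables (k : fieldType) (A : pzAlgType k) (gA : grading G A).
Local Notation S := (smash al gA).
Local Notation Xo e := (act_set al (idm G e)).

(** Taking the component of degree [g] of an arbitrary [a], and 0 if [x] is
    outside X_{dom g}, turns the partial notation [a delta_x] into a total
    function that is additive in [a]. *)
Definition delta_val (g : G) (x : X) (a : A) : {malg A[(G * X)%type]} :=
  if x \in Xo (dom g) then << (hcomp gA a)@_g *g (g, x) >> else 0.

Fact delta_subproof g x a : smash_pred al gA (delta_val g x a).
Proof.
rewrite /delta_val; case: ifPn => [xg|_].
  by apply: smash_predU => //=; exact: hcomp_gr.
by have [] := smash_zmod_closed al gA.
Qed.

Definition delta g x a : S := Smash (delta_subproof g x a).

Lemma smash_eqP (u v : S) : smash_val u = smash_val v -> u = v.
Proof. exact: val_inj. Qed.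

Lemma smash_val_sum (I : Type) (r : seq I) (P : pred I) (F : I -> S) :
  smash_val (\sum_(i <- r | P i) F i) = \sum_(i <- r | P i) smash_val (F i).
Proof. by apply: (big_morph (@smash_val _ _ _ _ _ _ gA)). Qed.

Lemma deltaD g x : {morph delta g x : a b / a + b}.
Proof.
move=> a b; apply: smash_eqP; rewrite /= /delta_val.
by case: ifP => _; rewrite ?addr0 // hcompD mcoeffD monalgUD.
Qed.

Lemma delta_out g x a : x \notin Xo (dom g) -> delta g x a = 0.
Proof. by move=> xg; apply: smash_eqP; rewrite /= /delta_val (negbTE xg). Qed.

Lemma val_delta g x a : a \in gA g -> x \in Xo (dom g) ->
  smash_val (delta g x a) = << a *g (g, x) >>.
Proof. by move=> ag xg; rewrite /= /delta_val xg (hcomp_homog ag) mcoeffUU. Qed.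

Lemma act_in g x : x \in Xo (dom g) -> al g x \in Xo (rng g).
Proof.
move=> xg; rewrite -act_set_rng -act_img imset_f //.
by rewrite act_set_rng rng_inv.
Qed.

Lemma deltaM g x a h y b : a \in gA g -> b \in gA h ->
  delta g x a * delta h y b =
  if (dom g == rng h) && (al h y == x) then delta (compg g h) y (a * b) else 0.
Proof.
move=> ag bh; have [yh|yh] := boolP (y \in Xo (dom h)); last first.
  rewrite (delta_out _ yh) mulr0; case: ifP => // /andP[/eqP gh _].
  by rewrite delta_out ?dom_comp.
have [xg|xg] := boolP (x \in Xo (dom g)); last first.
  rewrite (delta_out _ xg) mul0r; case: ifP => // /andP[/eqP gh /eqP hy].
  by rewrite -hy gh act_in in xg.
apply: smash_eqP.
transitivity (smash_mul_val al (smash_val (delta g x a))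
                               (smash_val (delta h y b))) => //.
rewrite !val_delta // smash_mul_valU /delta_mul /=.
case: ifP => // /andP[/eqP gh _].
by rewrite val_delta ?dom_comp // grM.
Qed.

Lemma smash_ind (P : S -> Prop) :
  P 0 -> (forall u v, P u -> P v -> P (u + v)) ->
  (forall g x a, x \in Xo (dom g) -> a \in gA g -> P (delta g x a)) ->
  forall u, P u.
Proof.
move=> P0 PD Pd u.
have -> : u = \sum_(p <- msupp (smash_val u)) delta p.1 p.2 (smash_val u)@_p.
  apply: smash_eqP; rewrite smash_val_sum [LHS]monalgE.
  apply: eq_big_seq => -[g x] /(allP (smash_valP u)) /= /andP[ag xg].
  by rewrite -val_delta.
rewrite big_seq; apply: (big_ind P) => // p /(allP (smash_valP u)) /andP[? ?].
exact: Pd.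
Qed.

Lemma smash_oneE : 1 = \sum_e \sum_x delta (idm G e) x (gr_unit gA e).
Proof.
apply: smash_eqP; rewrite smash_val_sum /= /smash_one_val; apply: eq_bigr => e _.
rewrite smash_val_sum big_mkcond; apply: eq_bigr => x _.
have [eA _] := gr_unitP gA e.
case: ifPn => [xe|xe]; first by rewrite val_delta ?dom_id.
by rewrite delta_out ?dom_id.
Qed.

(** The idempotent of [S] that will act as the projection to the component of
    degree [x]. The terms with [x] outside X_e vanish; for a split action
    the sum is [1_e delta_x], and summing avoids choosing [e] from [x]. *)
Definition eps x : S := \sum_e delta (idm G e) x (gr_unit gA e).

Lemma sum_eps : \sum_x eps x = 1.
Proof. by rewrite smash_oneE exchange_big. Qed.

Lemma delta_eps g x a y : a \in gA g ->
  delta g x a * eps y = if x == y then delta g x a else 0.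
Proof.
move=> ag.
have eA e : gr_unit gA e \in gA (idm G e) by have [] := gr_unitP gA e.
rewrite mulr_sumr (bigD1 (dom g)) //= big1 ?addr0 => [|e eg]; last first.
  by rewrite deltaM // rng_id eq_sym (negbTE eg).
have [yg|yg] := boolP (y \in Xo (dom g)); last first.
  rewrite [X in _ * X]delta_out ?dom_id // mulr0.
  by case: eqP => // ->; rewrite delta_out.
rewrite deltaM // rng_id eqxx act_id //= eq_sym compg1.
by have [_ ->] := gr_mul_unit ag; case: eqP => // ->.
Qed.

Lemma eps_delta g x a y : x \in Xo (dom g) -> a \in gA g ->
  eps y * delta g x a = if y == al g x then delta g x a else 0.
Proof.
move=> xg ag.
have eA e : gr_unit gA e \in gA (idm G e) by have [] := gr_unitP gA e.
rewrite mulr_suml (bigD1 (rng g)) //= big1 ?addr0 => [|e eg]; last first.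
  by rewrite deltaM // dom_id (negbTE eg).
rewrite deltaM // dom_id eqxx /= eq_sym comp1g.
by have [-> _] := gr_mul_unit ag.
Qed.

Lemma eps_eps x y : eps x * eps y = if x == y then eps y else 0.
Proof.
rewrite mulr_suml; under eq_bigr => e _ do
  [have [eA _] := gr_unitP gA e; rewrite delta_eps //].
by case: eqP => [->//|_]; rewrite big1.
Qed.

Definition eta (a : A) : S :=
  \sum_(g <- msupp (hcomp gA a)) \sum_x delta g x (hcomp gA a)@_g.

Fact sum_deltaD g : {morph (fun a => \sum_x delta g x a) : a b / a + b}.
Proof. by move=> a b; rewrite -big_split; apply: eq_bigr => x _; apply: deltaD. Qed.

Lemma etaD : {morph eta : a b / a + b}.
Proof. by move=> a b; rewrite /eta hcompD (msumD sum_deltaD). Qed.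

Lemma eta0 : eta 0 = 0.
Proof. by apply: (addrI (eta 0)); rewrite -etaD !addr0. Qed.

Lemma eta_homog g a : a \in gA g -> eta a = \sum_x delta g x a.
Proof. by move=> ag; rewrite /eta (hcomp_homog ag) (msumU sum_deltaD). Qed.

Lemma eta1 : eta 1 = 1.
Proof.
rewrite -[in LHS](sum_gr_unit gA) (big_morph eta etaD eta0) smash_oneE.
apply: eq_bigr => e _; apply: eta_homog.
by have [] := gr_unitP gA e.
Qed.

(** For homogeneous [a] and [b] of composable degrees [g] and [h], the terms of
    [eta a * eta b] are indexed by pairs [(x, y)], and the product of two
    terms is nonzero only for [x = al h y]: one term [a b delta_y] is left for
    each [y]. *)
Lemma etaM : {morph eta : a b / a * b}.
Proof.
move=> a b; move: a; apply: (gr_ind (gA := gA)) => [|a a' IH IH'|g a ag].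
- by rewrite !(mul0r, eta0).
- by rewrite mulrDl !etaD IH IH' mulrDl.
move: b; apply: (gr_ind (gA := gA)) => [|b b' IH IH'|h b bh].
- by rewrite !(mulr0, eta0).
- by rewrite mulrDr !etaD IH IH' mulrDr.
rewrite (eta_homog ag) (eta_homog bh) mulr_sumr.
have [gh|gh] := eqVneq (dom g) (rng h); last first.
  rewrite (grM0 gh ag bh) eta0 big1 // => y _; rewrite mulr_suml big1 // => x _.
  by rewrite deltaM // (negbTE gh).
rewrite (eta_homog (grM gh ag bh)); apply: eq_bigr => y _.
rewrite mulr_suml (bigD1 (al h y)) //= big1 ?addr0 => [|x].
  by rewrite deltaM // gh !eqxx.
by rewrite deltaM // gh eq_sym eqxx /= => /negbTE->.
Qed.

Lemma eta_eps g a x : a \in gA g -> eta a * eps x = delta g x a.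
Proof.
move=> ag; rewrite (eta_homog ag) mulr_suml (bigD1 x) //= big1 ?addr0 => [|y yx].
  by rewrite delta_eps ?eqxx.
by rewrite delta_eps // (negbTE yx).
Qed.
End SmashElements.

Definition linear_pack (R : pzRingType) (M N : lmodType R) (f : M -> N)
    (fL : linear f) : {linear M -> N} :=
  HB.pack f (GRing.isLinear.Build R M N *:%R f fL).

Section Equivalence.
Variables (O : finType) (G : groupoid O) (X : finType) (al : action G X).
Variables (k : fieldType) (A : pzAlgType k) (gA : grading G A).
Local Notation S := (smash al gA).
Local Notation Xo e := (act_set al (idm G e)).
Local Notation grmod := (graded_module al gA).

(** * From graded modules to modules over the smash product *)

Section ToSmash.
Variable M : grmod.

Lemma gm_part0 x : 0 \in gm_part M x.
Proof. by have [] := gm_subspace M x. Qed.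

Lemma gm_partD x : {in gm_part M x &, forall m n, m + n \in gm_part M x}.
Proof.
have [_ MD] := gm_subspace M x => m n mx nx.
by have := MD 1 m n mx nx; rewrite /mscale ascale1 scale1r.
Qed.

Definition gcomp x : M -> M := component (gm_direct (g0 := M)) x.

Lemma gcomp_in x m : gcomp x m \in gm_part M x.
Proof. exact: component_in. Qed.

Lemma gcompD x : {morph gcomp x : m n / m + n}.
Proof. by apply: componentD => y; apply: gm_partD. Qed.

Lemma gcomp_id x y m : m \in gm_part M y -> gcomp x m = if x == y then m else 0.
Proof. by apply: component_id => z; apply: gm_part0. Qed.

Definition sact (u : S) (m : M) : M :=
  \sum_(p <- msupp (smash_val u)) (smash_val u)@_p *: gcomp p.2 m.

Fact scale_gcompD m (p : G * X) :
  {morph (fun a : A => a *: gcomp p.2 m) : a b / a + b}.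
Proof. by move=> a b; rewrite scalerDl. Qed.

Lemma sactDl m : {morph sact^~ m : u v / u + v}.
Proof. by move=> u v; rewrite /sact -(msumD (scale_gcompD m)). Qed.

Lemma sactDr : right_distributive sact +%R.
Proof.
move=> u m n; rewrite /sact -big_split; apply: eq_bigr => p _.
by rewrite gcompD scalerDr.
Qed.

Lemma sact0l m : sact 0 m = 0.
Proof. by apply: (addrI (sact 0 m)); rewrite -sactDl !addr0. Qed.

Lemma sact0r u : sact u 0 = 0.
Proof. by apply: (addrI (sact u 0)); rewrite -sactDr !addr0. Qed.

Lemma sact_delta g x a m : a \in gA g ->
  sact (delta al gA g x a) m = a *: gcomp x m.
Proof.
move=> ag; have [xg|xg] := boolP (x \in Xo (dom g)).
  by rewrite /sact val_delta // (msumU (scale_gcompD m)).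
by rewrite delta_out // sact0l (gm_act0 xg ag (gcomp_in x m)).
Qed.

(** Elements of degree [idm e] with [x] outside X_e annihilate M_x, so summing
    [1_e delta_x] over all [e] gives the action of [\sum_e 1_e = 1] on M_x. *)
Lemma sact_eps x m : sact (eps al gA x) m = gcomp x m.
Proof.
rewrite /eps (big_morph (sact^~ m) (sactDl m) (sact0l m)).
rewrite -[RHS]scale1r -(sum_gr_unit gA) scaler_suml; apply: eq_bigr => e _.
by rewrite sact_delta //; have [] := gr_unitP gA e.
Qed.

Lemma sact1 : left_id 1 sact.
Proof.
move=> m; rewrite -sum_eps (big_morph (sact^~ m) (sactDl m) (sact0l m)).
by under eq_bigr do rewrite sact_eps; apply: sum_component.
Qed.

(** For [u = a delta_x] and [v = b delta_y], the vector [b *: m_y] is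
    homogeneous of degree [al h y], so its component of degree [x] is itself if
    [al h y = x] and 0 otherwise: this is the rule that defines the product
    of [S]. *)
Lemma sactA u v m : sact u (sact v m) = sact (u * v) m.
Proof.
move: u; apply: smash_ind => [|u u' IH IH'|g x a xg ag].
- by rewrite mul0r !sact0l.
- by rewrite mulrDl !sactDl IH IH'.
move: v; apply: smash_ind => [|v v' IH IH'|h y b yh bh].
- by rewrite mulr0 sact0l sact0r.
- by rewrite mulrDr !sactDl sactDr IH IH'.
rewrite !sact_delta // (gcomp_id _ (gm_act yh bh (gcomp_in y m))) deltaM //.
have [gh|gh] := eqVneq (dom g) (rng h); rewrite /= eq_sym; case: eqP => //= _.
- by rewrite scalerA sact_delta // grM.
- by rewrite scaler0 sact0l.
- by rewrite scalerA (grM0 gh ag bh) scale0r sact0l.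
- by rewrite scaler0 sact0l.
Qed.

Definition to_smash : lmodType S := rescale sactA sact1 sactDr sactDl.
End ToSmash.

Lemma gcomp_hom (M N : grmod) (f : graded_hom M N) x m :
  sval f (gcomp x m) = gcomp x (sval f m).
Proof.
have {2}<- := sum_component (gm_direct (g0 := M)) m; rewrite raddf_sum /gcomp.
rewrite component_uniq // => y; apply: (svalP f); exact: component_in.
Qed.

Lemma sact_hom (M N : grmod) (f : graded_hom M N) u m :
  sval f (sact u m) = sact u (sval f m).
Proof.
rewrite /sact linear_sum; apply: eq_bigr => p _.
by rewrite linearZ_LR -gcomp_hom.
Qed.

Fact to_smash_linear (M N : grmod) (f : graded_hom M N) :
  linear (sval f : to_smash M -> to_smash N).
Proof.
move=> u m n; rewrite raddfD; congr (_ + _); exact: sact_hom.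
Qed.

Definition to_smash_fhom (M N : grmod) (f : graded_hom M N) :
    {linear to_smash M -> to_smash N} := linear_pack (to_smash_linear f).

Fact to_smash_id (M : grmod) :
  to_smash_fhom (graded_id M) = lin_id (to_smash M).
Proof. exact: linear_inj. Qed.

Fact to_smash_comp (M N P : grmod) (f : graded_hom N P) (g : graded_hom M N) :
  to_smash_fhom (graded_comp f g) = lin_comp (to_smash_fhom f) (to_smash_fhom g).
Proof. exact: linear_inj. Qed.

Definition graded_to_smash :
    functor (graded_module_category al gA) (module_category S) :=
  @Functor (graded_module_category al gA) (module_category S)
    to_smash to_smash_fhom to_smash_id to_smash_comp.

(** * From modules over the smash product to graded modules *)

Section OfSmash.
Variable N : lmodType S.

Definition eact (a : A) (n : N) : N := eta al gA a *: n.

Fact eactA a b n : eact a (eact b n) = eact (a * b) n.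
Proof. by rewrite /eact scalerA etaM. Qed.
Fact eact1 : left_id 1 eact.
Proof. by move=> n; rewrite /eact eta1 scale1r. Qed.
Fact eactDr : right_distributive eact +%R.
Proof. by move=> a m n; apply: scalerDr. Qed.
Fact eactDl n : {morph eact^~ n : a b / a + b}.
Proof. by move=> a b; rewrite /eact etaD scalerDl. Qed.

Definition of_smash_lmod : lmodType A := rescale eactA eact1 eactDr eactDl.

Definition eps_part x : {pred of_smash_lmod} :=
  [pred n : N | eps al gA x *: n == n].

Lemma eps_partP x (n : N) : reflect (eps al gA x *: n = n) (n \in eps_part x).
Proof. exact: eqP. Qed.

Fact of_smash_direct : direct_sum eps_part.
Proof.
apply: (direct_sum_proj (p := fun x (n : N) => eps al gA x *: n)) => //.
- by move=> x m n; apply: scalerDr.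
- by move=> n; rewrite -[LHS]scaler_suml sum_eps; apply: scale1r.
by move=> x y n; rewrite scalerA eps_eps; case: ifP => // _; apply: scale0r.
Qed.

Lemma scale_eps_part g x a (n : of_smash_lmod) : a \in gA g -> n \in eps_part x ->
  a *: n = delta al gA g x a *: (n : N) :> N.
Proof. by move=> ag /eps_partP nx; rewrite -(eta_eps al x ag) -scalerA nx. Qed.

Fact of_smash_act g x : x \in Xo (dom g) ->
  forall a (n : of_smash_lmod), a \in gA g -> n \in eps_part x ->
  a *: n \in eps_part (al g x).
Proof.
move=> xg a n ag nx; apply/eps_partP.
by rewrite (scale_eps_part ag nx) scalerA eps_delta // eqxx.
Qed.

Fact of_smash_act0 g x : x \notin Xo (dom g) ->
  forall a (n : of_smash_lmod), a \in gA g -> n \in eps_part x -> a *: n = 0.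
Proof.
move=> xg a n ag nx; rewrite (scale_eps_part ag nx).
by rewrite delta_out ?scale0r.
Qed.

Fact of_smash_subspace x : subspace (@mscale k A of_smash_lmod) (eps_part x).
Proof.
have h0 : 0 \in eps_part x by apply/eps_partP; apply: scaler0.
have hD (m n : N) : m \in eps_part x -> n \in eps_part x -> m + n \in eps_part x.
  by move=> /eps_partP mx /eps_partP nx; apply/eps_partP; rewrite scalerDr mx nx.
split=> // c m n mx nx; apply: (hD) => //.
(* A scalar [c] acts as [\sum_e c 1_e], whose terms are homogeneous. *)
rewrite /mscale -(sum_gr_unit gA).
rewrite (big_morph (ascale c) (ascaleDr c) (ascale0r A c)) scaler_suml.
apply: (big_ind (fun n => n \in eps_part x) h0 hD) => e _.
have ce : ascale c (gr_unit gA e) \in gA (idm G e).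
  by apply: grZ; have [] := gr_unitP gA e.
have [xe|xe] := boolP (x \in Xo e).
  by rewrite -(act_id xe); apply: of_smash_act => //; rewrite dom_id.
by rewrite (of_smash_act0 _ ce mx) // dom_id.
Qed.

Definition of_smash : grmod :=
  GradedModule of_smash_subspace of_smash_direct of_smash_act of_smash_act0.
End OfSmash.

Fact of_smash_linear (M N : lmodType S) (f : {linear M -> N}) :
  linear (f : of_smash M -> of_smash N).
Proof. by move=> a m n; apply: (linearP f). Qed.

Fact of_smash_hom (M N : lmodType S) (f : {linear M -> N}) x (m : of_smash M) :
  m \in gm_part (of_smash M) x ->
  linear_pack (of_smash_linear f) m \in gm_part (of_smash N) x.
Proof.
by move=> /eps_partP mx; apply/eps_partP; rewrite -[in RHS]mx /= linearZ.
Qed.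

Definition of_smash_fhom (M N : lmodType S) (f : {linear M -> N}) :
    graded_hom (of_smash M) (of_smash N) :=
  exist _ (linear_pack (of_smash_linear f)) (@of_smash_hom M N f).

Fact of_smash_id (M : lmodType S) :
  of_smash_fhom (lin_id M) = graded_id (of_smash M).
Proof. exact: graded_hom_inj. Qed.

Fact of_smash_comp (M N P : lmodType S) (f : {linear N -> P})
    (g : {linear M -> N}) :
  of_smash_fhom (lin_comp f g) = graded_comp (of_smash_fhom f) (of_smash_fhom g).
Proof. exact: graded_hom_inj. Qed.

Definition smash_to_graded :
    functor (module_category S) (graded_module_category al gA) :=
  @Functor (module_category S) (graded_module_category al gA)
    of_smash of_smash_fhom of_smash_id of_smash_comp.

(** * The two constructions are mutually inverse *)

(** The action of [a delta_x] on the graded module of [N] is [eta a * eps x],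
    which is [a delta_x] again. *)
Lemma to_smash_ofK (N : lmodType S) : to_smash (of_smash N) = N.
Proof.
apply: rescale_id => u n.
have pE x : gcomp (M := of_smash N) x n = eps al gA x *: (n : N).
  have {1}-> : n = \sum_y eps al gA y *: (n : N).
    by rewrite -scaler_suml sum_eps scale1r.
  apply: (@component_uniq _ _ _ _ (fun y => eps al gA y *: (n : N))) => y.
  by apply/eps_partP; rewrite scalerA eps_eps eqxx.
move: u; apply: smash_ind => [|u v IH IH'|g x a xg ag].
- by rewrite sact0l scale0r.
- by rewrite sactDl IH IH' scalerDl.
rewrite sact_delta // -[LHS]/(eta al gA a *: (gcomp (M := of_smash N) x n : N)).
by rewrite pE scalerA (eta_eps al x ag).
Qed.

(** The action of [eta a] on [M] is the sum over [x] of the maps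
    [m |-> a *: m_x], and the components of [m] sum up to [m]. *)
Lemma of_to_smash_scale (M : grmod) a (m : M) :
  eact (N := to_smash M) a m = a *: m.
Proof.
rewrite -[LHS]/(sact (eta al gA a) m).
move: a; apply: (gr_ind (gA := gA)) => [|a b IH IH'|g a ag].
- by rewrite eta0 sact0l scale0r.
- by rewrite etaD sactDl IH IH' scalerDl.
rewrite (eta_homog al ag) (big_morph (fun u => sact u m) (sactDl m) (sact0l m)).
under eq_bigr do rewrite sact_delta //.
by rewrite -scaler_sumr sum_component.
Qed.

Lemma of_smash_toK_lmod (M : grmod) :
  of_smash (to_smash M) = M :> lmodType A.
Proof. by apply: rescale_id => a m; apply: of_to_smash_scale. Qed.

Lemma of_smash_toK (M : grmod) : of_smash (to_smash M) = M.
Proof.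
apply: (graded_module_eq (E := of_smash_toK_lmod M)) => x m.
rewrite recast_rescale -[LHS]/(sact (eps al gA x) (m : M) == m) sact_eps.
by rewrite (mem_component (gm_direct (g0 := M))) // => y; apply: gm_part0.
Qed.

Lemma eq_hom_of_smash_toK (M : graded_module_category al gA)
    (E : (of_smash (to_smash M) : graded_module_category al gA) = M) m :
  sval (eq_hom E) m = m.
Proof. by rewrite eq_hom_graded; apply: recast_rescale. Qed.

Lemma eq_hom_to_smash_ofK (N : module_category S)
    (E : (to_smash (of_smash N) : module_category S) = N) n :
  (eq_hom E : {linear _ -> _}) n = n.
Proof. by rewrite eq_hom_module; apply: recast_rescale. Qed.
End Equivalence.

Theorem theorem5p1 (G0 : finType) (G : groupoid G0) (k : fieldType)
    (A : pzAlgType k) (gA : grading G A) (X : finType) (al : action G X)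
    (split_al : split_action al) :
  isomorphic_categories (graded_module_category al gA)
                        (module_category (smash al gA)).
Proof.
exists (graded_to_smash al gA), (smash_to_graded al gA); split.
- have E M : functor_comp (smash_to_graded al gA) (graded_to_smash al gA) M = M.
    exact: of_smash_toK.
  apply: (functor_eq_id (E := E)) => M N f; apply: graded_hom_inj => m.
  transitivity (sval f m); first exact: (eq_hom_of_smash_toK (E N)).
  by congr (sval f _); apply/esym/(eq_hom_of_smash_toK (E M)).
- have E N : functor_comp (graded_to_smash al gA) (smash_to_graded al gA) N = N.
    exact: to_smash_ofK.
  apply: (functor_eq_id (E := E)) => M N f; apply: linear_inj => n.
  transitivity ((f : {linear _ -> _}) n).
    exact: (eq_hom_to_smash_ofK (E N)).
  by congr ((f : {linear _ -> _}) _); apply/esym/(eq_hom_to_smash_ofK (E M)).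
Qed.
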